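(* Let $D\subseteq X$ be nonempty and $\tau_X$-open, let $T_1,T_2:D\to Y$ be single-valued mappings, let $\bar x\in D$, and let $a_1,a_2$ be scalars. Suppose that both $T_1$ and $T_2$ are Fréchet differentiable at $\bar x$. Then $a_1T_1+a_2T_2:D\to Y$ is Fréchet differentiable at $\bar x$ and $\nabla(a_1T_1+a_2T_2)(\bar x)=a_1\nabla T_1(\bar x)+a_2\nabla T_2(\bar x)$.
   Context: An $F$-seminorm on a real vector space $X$ is a map $p:X\to[0,\infty)$ with $p(x+y)\le p(x)+p(y)$; $p(ax)\le p(x)$ for all scalars $|a|\le 1$; and $p(a_nx)\to0$ for every $x$ and every sequence of positive numbers $a_n\to0$. It is positive if not identically $0$. A topology $\tau_X$ is induced by a family $\mathbb{F}_X$ of $F$-seminorms if for every $x_0\in X$ the sets $\{x:\max\{p(x-x_0):p\in I\}<\lambda\}$, with $I\subseteq\mathbb{F}_X$ nonempty finite and $\lambda>0$, form a base of $\tau_X$-open neighborhoods of $x_0$. $\mathcal{F}_X$ is the collection of nonempty finite subsets of $\mathbb{F}_X$ (similarly $\mathcal{F}_Y$). $(X,\tau_X)$ and $(Y,\tau_Y)$ are real Hausdorff topological vector spaces whose topologies are induced by families $\mathbb{F}_X$ and $\mathbb{F}_Y$ of positive $F$-seminorms. $T:D\to Y$ is Fréchet differentiable at $\bar x\in D$ with Fréchet derivative $\nabla T(\bar x)=A$ if $A:X\to Y$ is a continuous linear mapping such that for every $J\in\mathcal{F}_Y$ and $\varepsilon>0$ there are $I\in\mathcal{F}_X$ and $\delta>0$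 (with $\bar x+u\in D$ whenever $\max\{p(u):p\in I\}<\delta$) such that for all $u\in X$: (DZ) if $\max\{p(u):p\in I\}=0$ then $\max\{q(T(\bar x+u)-T(\bar x)-A(u)):q\in J\}=0$; and (DR) if $0<\max\{p(u):p\in I\}<\delta$ then $\max\left\{q\left(\frac{T(\bar x+u)-T(\bar x)-A(u)}{\max\{p(u):p\in I\}}\right):q\in J\right\}<\varepsilon$. The equation $\nabla T(\bar x)=A$ is the assertion that $A$ has these properties; thus the conclusion says that whenever $\nabla T_1(\bar x),\nabla T_2(\bar x)$ are Fréchet derivatives of $T_1,T_2$ at $\bar x$, the stated combination is a Fréchet derivative of $a_1T_1+a_2T_2$ at $\bar x$. *)

(* Defs.v *)
From HB Require Import structures.
From mathcomp Require Import all_boot all_order all_algebra finmap.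
From mathcomp Require Import all_classical all_reals all_analysis.
Import Order.TTheory GRing.Theory Num.Theory.
Import numFieldNormedType.Exports.

Set Implicit Arguments.
Unset Strict Implicit.
Unset Printing Implicit Defensive.

Local Open Scope classical_set_scope.
Local Open Scope ring_scope.

Definition is_Fseminorm (R : realType) (X : lmodType R) (p : X -> R) : Prop :=
  [/\ forall x, 0 <= p x,
      forall x y, p (x + y) <= p x + p y,
      forall (a : R) x, `|a| <= 1 -> p (a *: x) <= p x
    & forall x (a : nat -> R), (forall n, 0 < a n) ->
        a @ \oo --> 0 -> (fun n => p (a n *: x)) @ \oo --> 0].

Definition positive_Fseminorm (R : realType) (X : lmodType R) (p : X -> R)
    : Prop :=
  is_Fseminorm p /\ exists x, p x != 0.

Definition nonempty_finite_sub (T : choiceType) (F : set T) : set {fset T} :=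
  [set I | I != fset0 /\ forall p, p \in I -> F p].

(* Starting the maximum at 0 is harmless: it is only used for nonempty
   families of nonnegative functions. *)
Definition maxp (R : realType) (X : lmodType R) (I : {fset (X -> R)}) (x : X)
    : R :=
  \big[Num.max/0]_(p <- I) p x.

Definition Fball (R : realType) (X : lmodType R) (I : {fset (X -> R)}) (x0 : X)
    (l : R) : set X :=
  [set x | maxp I (x - x0) < l].

Definition induced_by (R : realType) (X : topologicalLmodType R)
    (FX : set (X -> R)) : Prop :=
  forall x0 : X,
    (forall I l, nonempty_finite_sub FX I -> 0 < l -> open (Fball I x0 l)) /\
    (forall U : set X, nbhs x0 U ->
       exists I l, [/\ nonempty_finite_sub FX I, 0 < l & Fball I x0 l `<=` U]).

Definition frechet_derivative (R : realType) (X Y : topologicalLmodType R)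
    (FX : set (X -> R)) (FY : set (Y -> R)) (D : set X)
    (T : D -> Y) (xbar : D) (A : X -> Y) : Prop :=
  [/\ linear A, continuous A
    & forall J (e : R), nonempty_finite_sub FY J -> 0 < e ->
      exists I (d : R),
        [/\ nonempty_finite_sub FX I, 0 < d,
            forall u, maxp I u < d -> val xbar + u \in D
          & forall (u : X) (xuD : val xbar + u \in D),
              let r := T (exist _ (val xbar + u) xuD) - T xbar - A u in
              (maxp I u = 0 -> maxp J r = 0) /\
              (0 < maxp I u < d -> maxp J ((maxp I u)^-1 *: r) < e)]].

Definition frechet_differentiable (R : realType) (X Y : topologicalLmodType R)
    (FX : set (X -> R)) (FY : set (Y -> R)) (D : set X)
    (T : D -> Y) (xbar : D) : Prop :=
  exists A, frechet_derivative FX FY T xbar A.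

(* Main.v *)
(** On a common family [I1 `|` I2] the maximum [m] dominates both original
    maxima [m1], [m2], so [m^-1 *: r] is a contraction of [m1^-1 *: r], which an
    F-seminorm does not increase. The coefficients are absorbed by an integer
    bound [n]: although F-seminorms are not homogeneous, subadditivity and
    contractivity give [q (a *: x) <= n * q x] when [`|a| <= n]. *)
Require Import Defs.
From mathcomp Require Import all_boot all_order all_algebra finmap.
From mathcomp Require Import all_classical all_reals all_analysis.
Import Order.TTheory GRing.Theory Num.Theory.
Import numFieldNormedType.Exports.
Local Open Scope classical_set_scope.
Local Open Scope ring_scope.

Set Implicit Arguments.
Unset Strict Implicit.
Unset Printing Implicit Defensive.

Section MaxFseminorms.
Context (R : realType) (X : lmodType R).
Implicit Types (I : {fset (X -> R)}) (x y : X).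

Lemma maxp_ge0 I x : 0 <= maxp I x.
Proof. exact: bigmax_ge_id. Qed.

Lemma le_maxp I (p : X -> R) x : p \in I -> p x <= maxp I x.
Proof.
move=> pI.
exact: (@le_bigmax_seq _ _ _ _ 0 p xpredT (fun q : X -> R => q x)).
Qed.

Lemma maxp_le I x (b : R) :
  0 <= b -> (forall p, p \in I -> p x <= b) -> maxp I x <= b.
Proof.
by move=> b0 pb; rewrite /maxp big_seq; apply: bigmax_le => // p; apply: pb.
Qed.

Lemma maxpS I I' x : {subset I <= I'} -> maxp I x <= maxp I' x.
Proof.
move=> sII'; apply: maxp_le; first exact: maxp_ge0.
by move=> p /sII'; apply: le_maxp.
Qed.

Context (I : {fset (X -> R)}).
Hypothesis semiI : forall p, p \in I -> is_Fseminorm p.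

Lemma maxpD x y : maxp I (x + y) <= maxp I x + maxp I y.
Proof.
apply: maxp_le => [|p pI]; first by rewrite addr_ge0 ?maxp_ge0.
have [_ pD _ _] := semiI pI.
by apply: le_trans (pD _ _) _; rewrite lerD ?le_maxp.
Qed.

Lemma maxp_contract (a : R) x : `|a| <= 1 -> maxp I (a *: x) <= maxp I x.
Proof.
move=> a1; apply: maxp_le => [|p pI]; first exact: maxp_ge0.
have [_ _ pZ _] := semiI pI.
by apply: le_trans (pZ _ _ a1) _; exact: le_maxp.
Qed.

(** Subadditivity, once per added summand. The count starts at one: for the empty sum the bound
    would say [maxp I 0 = 0], which rests on the limit axiom. *)
Lemma maxp_mulrSn x (n : nat) : maxp I (x *+ n.+1) <= n.+1%:R * maxp I x.
Proof.
elim: n => [|n IHn]; first by rewrite mul1r mulr1n.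
rewrite mulrSr -natr1 mulrDl mul1r.
by apply: le_trans (maxpD _ _) _; rewrite lerD2r.
Qed.

Lemma maxpZ_le (a : R) (n : nat) x :
  `|a| <= n.+1%:R -> maxp I (a *: x) <= n.+1%:R * maxp I x.
Proof.
move=> an; have n0 : n.+1%:R != 0 :> R by rewrite pnatr_eq0.
(* Split [a] as [a / n.+1%:R] times [n.+1%:R]: the first factor is a contraction, the second an
   iterated sum. *)
rewrite -[a](divfK n0) -scalerA scaler_nat.
apply: le_trans (maxp_contract _ _) (maxp_mulrSn _ _).
by rewrite normrM normfV normr_nat ler_pdivrMr ?mul1r.
Qed.

(** Every [|a|] lies below some integer, so the preceding bound replaces homogeneity at zeros. This
    serves both (DZ) and the degenerate case of (DR). *)
Lemma maxpZ_eq0 (a : R) x : maxp I x = 0 -> maxp I (a *: x) = 0.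
Proof.
move=> x0; apply/eqP; rewrite eq_le maxp_ge0 andbT.
have := maxpZ_le x (ltW (truncnS_gt `|a|)).
by rewrite x0 mulr0.
Qed.

End MaxFseminorms.

(** Lets the remainders of [T1] and [T2], controlled by different families, be compared on one
    common family, with the same [d] and [e]. *)
Lemma maxp_remainder (R : realType) (X Y : lmodType R)
    (I I' : {fset (X -> R)}) (J : {fset (Y -> R)}) (u : X) (r : Y) (d e : R) :
  {subset I <= I'} -> (forall q, q \in J -> is_Fseminorm q) -> 0 < e ->
  (maxp I u = 0 -> maxp J r = 0) ->
  (0 < maxp I u < d -> maxp J ((maxp I u)^-1 *: r) < e) ->
  (maxp I' u = 0 -> maxp J r = 0) /\
  (0 < maxp I' u < d -> maxp J ((maxp I' u)^-1 *: r) < e).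
Proof.
move=> sII' semiJ e0 DZ DR; have lem := maxpS u sII'.
split=> [m0|/andP[m'0 m'd]].
  by apply: DZ; apply/eqP; rewrite eq_le maxp_ge0 andbT -m0.
(* The larger maximum may be positive while the smaller one vanishes. Then (DR) for [I] is silent,
   but (DZ) for [I] kills the remainder. *)
have [m0|m0] := eqVneq (maxp I u) 0; first by rewrite maxpZ_eq0 // DZ.
have mgt0 : 0 < maxp I u by rewrite lt_def m0 maxp_ge0.
have -> : (maxp I' u)^-1 *: r =
    (maxp I u / maxp I' u) *: ((maxp I u)^-1 *: r).
  by rewrite scalerA mulrAC divff // mul1r.
apply: le_lt_trans (maxp_contract _ _ _) _ => //.
  by rewrite ger0_norm ?divr_ge0 ?maxp_ge0 // ler_pdivrMr // mul1r.
by apply: DR; rewrite mgt0 (le_lt_trans lem).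
Qed.

Lemma continuous_lin_comb (R : realType) (X : topologicalType)
    (Y : topologicalLmodType R) (A1 A2 : X -> Y) (a1 a2 : R) :
  continuous A1 -> continuous A2 ->
  continuous (fun u => a1 *: A1 u + a2 *: A2 u).
Proof.
move=> cA1 cA2 u.
have cZ (a : R) (A : X -> Y) :
    continuous A -> {for u, continuous (fun v => a *: A v)}.
  (* Scaling by a fixed [a] is the jointly continuous scaling composed with a constant scalar map;
     [R^o] is [R] seen as a space over itself. *)
  move=> cA; apply: (@continuous2_cvg _ _ _ _ _ _ _ _
    (fun (b : R^o) y => b *: y)).
  - exact: (@scale_continuous R Y (a, A u)).
  - exact: cvg_cst.
  - exact: cA.
apply: (@continuous2_cvg _ _ _ _ _ _ _ _ (fun y z : Y => y + z)).
- exact: (@add_continuous Y (a1 *: A1 u, a2 *: A2 u)).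
- exact: cZ.
- exact: cZ.
Qed.

Lemma nonempty_finite_subU (T : choiceType) (F : set T) (I I' : {fset T}) :
  nonempty_finite_sub F I -> nonempty_finite_sub F I' ->
  nonempty_finite_sub F (I `|` I')%fset.
Proof.
move=> [I0 IF] [_ I'F]; split=> [|p]; last by rewrite inE => /orP[/IF|/I'F].
have /fset0Pn[p pI] := I0.
by apply/fset0Pn; exists p; rewrite inE pI.
Qed.

Lemma frechet_derivative_lin_comb (R : realType) (X Y : topologicalLmodType R)
    (FX : set (X -> R)) (FY : set (Y -> R)) (D : set X) (T1 T2 : D -> Y)
    (xbar : D) (a1 a2 : R) (A1 A2 : X -> Y) :
  (forall q, FY q -> is_Fseminorm q) ->
  frechet_derivative FX FY T1 xbar A1 ->
  frechet_derivative FX FY T2 xbar A2 ->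
  frechet_derivative FX FY (fun x => a1 *: T1 x + a2 *: T2 x) xbar
    (fun u => a1 *: A1 u + a2 *: A2 u).
Proof.
move=> semiFY [linA1 cA1 dA1] [linA2 cA2 dA2].
split; [|exact: continuous_lin_comb|] => [b u v|J e FJ e0].
  rewrite linA1 linA2 !scalerDr !scalerA [a1 * b]mulrC [a2 * b]mulrC.
  by rewrite -!scalerA addrACA -!scalerDr.
have semiJ q : q \in J -> is_Fseminorm q by move=> /FJ.2 /semiFY.
pose n := Num.truncn (Num.max `|a1| `|a2|).
have /ltW := truncnS_gt (Num.max `|a1| `|a2|).
rewrite ge_max -/n => /andP[a1n a2n].
(* Each of the two terms is enlarged by at most [n.+1%:R], so each contributes less than [e / 2]. *)
pose e' := e / (n.+1%:R * 2).
have e'0 : 0 < e' by rewrite divr_gt0 // mulr_gt0.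
have [I1 [d1 [FI1 d10 D1 rem1]]] := dA1 J e' FJ e'0.
have [I2 [d2 [FI2 d20 D2 rem2]]] := dA2 J e' FJ e'0.
have sI1 : {subset I1 <= (I1 `|` I2)%fset} by move=> p; rewrite inE => ->.
have sI2 : {subset I2 <= (I1 `|` I2)%fset} by move=> p; rewrite inE orbC => ->.
exists (I1 `|` I2)%fset, (Num.min d1 d2); split.
- exact: nonempty_finite_subU.
- by rewrite lt_min d10.
- move=> u; rewrite lt_min => /andP[ud1 _]; apply: D1.
  exact: le_lt_trans (maxpS u sI1) ud1.
move=> u xuD /=; have [DZ1 DR1] := rem1 u xuD; have [DZ2 DR2] := rem2 u xuD.
have {DZ1 DR1} [] := maxp_remainder sI1 semiJ e'0 DZ1 DR1.
have {DZ2 DR2} [] := maxp_remainder sI2 semiJ e'0 DZ2 DR2.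
set m := maxp _ u; set r1 := T1 _ - _ - _; set r2 := T2 _ - _ - _.
move=> DZ2 DR2 DZ1 DR1.
(* The remainder depends linearly on the pair of mapping and derivative. *)
have -> : a1 *: T1 (exist _ (val xbar + u) xuD) +
    a2 *: T2 (exist _ (val xbar + u) xuD) - (a1 *: T1 xbar + a2 *: T2 xbar) -
    (a1 *: A1 u + a2 *: A2 u) = a1 *: r1 + a2 *: r2.
  by rewrite /r1 /r2 !scalerBr [RHS]addrACA [X in _ = X + _]addrACA -!opprD.
split=> [m0|/andP[m0]].
  apply/eqP; rewrite eq_le maxp_ge0 andbT.
  by apply: le_trans (maxpD _ _ _) _; rewrite ?maxpZ_eq0 ?addr0 ?DZ1 ?DZ2.
rewrite lt_min => /andP[md1 md2].
(* Move [m^-1] next to each remainder, the form that (DR) bounds, leaving [a1] and [a2] outside for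
   [maxpZ_le]. *)
rewrite scalerDr !scalerA ![m^-1 * _]mulrC -!scalerA.
apply: le_lt_trans (maxpD semiJ _ _) _.
apply: le_lt_trans (lerD (maxpZ_le semiJ _ a1n) (maxpZ_le semiJ _ a2n)) _.
rewrite -mulrDr mulrC -ltr_pdivlMr //.
have -> : e / n.+1%:R = e' + e'.
  by rewrite /e' invfM mulrA -splitr.
by apply: ltrD; [apply: DR1; rewrite m0 | apply: DR2; rewrite m0].
Qed.

Theorem theorem4p14 (R : realType) (X Y : topologicalLmodType R)
    (FX : set (X -> R)) (FY : set (Y -> R))
    (hausdorffX : hausdorff_space X) (hausdorffY : hausdorff_space Y)
    (positiveFX : forall p, FX p -> positive_Fseminorm p)
    (positiveFY : forall q, FY q -> positive_Fseminorm q)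
    (inducedX : induced_by FX) (inducedY : induced_by FY)
    (D : set X) (D0 : D !=set0) (openD : open D)
    (T1 T2 : D -> Y) (xbar : D) (a1 a2 : R)
    (diffT1 : frechet_differentiable FX FY T1 xbar)
    (diffT2 : frechet_differentiable FX FY T2 xbar) :
  frechet_differentiable FX FY (fun x => a1 *: T1 x + a2 *: T2 x) xbar /\
  forall A1 A2 : X -> Y,
    frechet_derivative FX FY T1 xbar A1 ->
    frechet_derivative FX FY T2 xbar A2 ->
    frechet_derivative FX FY (fun x => a1 *: T1 x + a2 *: T2 x) xbar
      (fun u => a1 *: A1 u + a2 *: A2 u).
Proof.
have semiFY q : FY q -> is_Fseminorm q by move=> /positiveFY[].
split; last by move=> A1 A2; exact: frechet_derivative_lin_comb.
(* Any choice of derivatives of [T1] and [T2] yields a witness. *)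
have [[A1 dA1] [A2 dA2]] := (diffT1, diffT2).
by eexists; apply: frechet_derivative_lin_comb dA1 dA2.
Qed.
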